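(* Let $\mathfrak g=\mathfrak{gl}_n$ be the Lie algebra of $n\times n$-matrices over $\mathbb K=\mathbb R$ or $\mathbb C$ with the commutator bracket, and let $N=L_A:\mathfrak g\to\mathfrak g$, $x\mapsto Ax$, be the (Nijenhuis) operator of left multiplication by a diagonal matrix $A=\operatorname{diag}(\lambda_1,\ldots,\lambda_n)\in\mathfrak g$ with $\lambda_i\neq\lambda_j$ for $i\neq j$. Then the corresponding Poisson pencil $\{\theta_N^s\}$ is Kronecker.
   Context: A linear operator $N:\mathfrak g\to\mathfrak g$ on a Lie algebra $(\mathfrak g,[,])$ is called Nijenhuis if $[Nx,Ny]-N([Nx,y]+[x,Ny])+N^2[x,y]=0$ for all $x,y\in\mathfrak g$. For a Nijenhuis operator $N$, the operation $[x,y]_N:=[Nx,y]+[x,Ny]-N[x,y]$ is a Lie bracket on $\mathfrak g$, and every linear combination $s_1[,]+s_2[,]_N$ is a Lie bracket. For $N=L_A$ one has $[x,y]_N=xAy-yAx$. If $\mathbb K=\mathbb C$, let $\theta_1,\theta_2$ be the (holomorphic) Lie–Poisson bivectors on $\mathfrak g^*$ corresponding to $[,]$ and $[,]_N$ respectively; the associated Poisson pencil is the family $\theta_N^s:=s_1\theta_1+s_2\theta_2$, $s=(s_1,s_2)\in\mathbb C^2$. If $\mathbb K=\mathbb R$, one complexifies $\mathfrak g$ and $N$ and takes the pencil $\{\theta_N^s\}_{s\in\mathbb C^2}$ so obtained on $(\mathfrak g^{\mathbb C})^*$. A Poisson pencil $\{\theta^s\}$ on a connected complex manifold $M$ is Kronecker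 at $x\in M$ if $\operatorname{rank}_{\mathbb C}\theta^s_x$ is constant with respect to $s\in\mathbb C^2\setminus\{0\}$; the pencil is called Kronecker (micro-Kronecker) if it is Kronecker at every point of some open dense subset of $M$. *)

(* Defs.v *)
From HB Require Import structures.
From mathcomp Require Import all_boot all_order all_algebra.
From mathcomp Require Import complex.
From mathcomp Require Import all_classical all_reals.
From mathcomp Require Import topology normedtype.
From mathcomp Require Import ring.

Set Implicit Arguments.
Unset Strict Implicit.
Unset Printing Implicit Defensive.

Import Order.TTheory GRing.Theory Num.Theory numFieldNormedType.Exports.
Local Open Scope classical_set_scope.
Local Open Scope ring_scope.
Local Open Scope complex_scope.

Import VectorInternalTheory.

Section LieAlgebra.
Variables (K : fieldType) (g : vectType K).
Implicit Types (br : g -> g -> g) (N : g -> g).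

Definition is_lie_bracket br : Prop :=
  [/\ forall x, linear (br x),
      forall y, linear (br^~ y),
      forall x, br x x = 0
    & forall x y z, br x (br y z) + br y (br z x) + br z (br x y) = 0].

Definition nijenhuis br N : Prop :=
  linear N /\
  forall x y, br (N x) (N y) - N (br (N x) y + br x (N y)) + N (N (br x y)) = 0.

Definition deformed_bracket br N (x y : g) : g :=
  br (N x) y + br x (N y) - N (br x y).

End LieAlgebra.

Section PoissonPencil.
Variables (C : numFieldType) (g : vectType C).

(* The linear dual of g with the topology of pointwise convergence; since g is
   finite-dimensional, this is the usual topology of the vector space g^*. *)
Definition dual : Type :=
  initial_topology (fun xi : 'Hom(g, C^o) => (xi : {ptws g -> C})).
HB.instance Definition _ := Topological.on dual.

(* A bivector at a point of g^* is given as a bilinear form on the cotangent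
   space of g^* at that point, which is g itself. *)
Definition bivector_field : Type := dual -> g -> g -> C.

Definition lie_poisson (br : g -> g -> g) : bivector_field :=
  fun xi x y => (xi : 'Hom(g, C^o)) (br x y).

Definition poisson_pencil (br : g -> g -> g) (N : g -> g) (s : C * C) :
    bivector_field :=
  fun xi x y => s.1 * lie_poisson br xi x y
              + s.2 * lie_poisson (deformed_bracket br N) xi x y.

(* The rank of the linear map x |-> b(x, .) from the cotangent space g to the
   tangent space g^*; linfun agrees with its argument because b is bilinear. *)
Definition bivector_rank (b : g -> g -> C) : nat :=
  \dim (limg (linfun (fun x : g => linfun (b x : g -> C^o) : 'Hom(g, C^o)))).

Definition kronecker_at (theta : C * C -> bivector_field) (xi : dual) : Prop :=
  forall s t : C * C, s != 0 -> t != 0 ->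
    bivector_rank (theta s xi) = bivector_rank (theta t xi).

Definition kronecker (theta : C * C -> bivector_field) : Prop :=
  exists U : set dual,
    [/\ open U, dense U & forall xi, U xi -> kronecker_at theta xi].

End PoissonPencil.

Section Complexification.
Variables (R : realType) (V : vectType R).

(* (u, v) stands for u + i v. *)
Definition complexification : Type := (V * V)%type.
HB.instance Definition _ := GRing.Zmodule.on complexification.

Definition complexification_scale (a : R[i]) (w : complexification) :
    complexification :=
  (complex.Re a *: w.1 - complex.Im a *: w.2,
   complex.Re a *: w.2 + complex.Im a *: w.1).

Local Ltac by_coordinates :=
  apply: v2r_inj; apply/rowP => j; rewrite !(linearD, linearN, linearZ) !mxE /=; ring.

Fact complexification_scaleA a b w :
  complexification_scale a (complexification_scale b w) =
  complexification_scale (a * b) w.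
Proof.
case: a b w => [a1 a2] [b1 b2] [u v].
by congr (_, _); by_coordinates.
Qed.

Fact complexification_scale1 : left_id 1 complexification_scale.
Proof. by case=> u v; congr (_, _); by_coordinates. Qed.

Fact complexification_scaleDr : right_distributive complexification_scale +%R.
Proof.
by case=> [a1 a2] [u v] [u' v']; congr (_, _); by_coordinates.
Qed.

Fact complexification_scaleDl w :
  {morph complexification_scale^~ w : a b / a + b}.
Proof.
by case: w => u v [a1 a2] [b1 b2]; congr (_, _); by_coordinates.
Qed.

HB.instance Definition _ :=
  GRing.Zmodule_isLmodule.Build R[i] complexification
    complexification_scaleA complexification_scale1
    complexification_scaleDr complexification_scaleDl.

Fact complexification_vect_iso : Vector.axiom (dim V) complexification.
Proof.
exists (fun w : complexification => \row_j (v2r w.1 0 j +i* v2r w.2 0 j)).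
  move=> [a1 a2] [u v] [u' v']; apply/rowP => j; rewrite !mxE /=.
  by rewrite !(linearD, linearN, linearZ) !mxE /=; apply/eqP; rewrite eq_complex /=;
     apply/andP; split; apply/eqP; ring.
exists (fun r : 'rV[R[i]]_(dim V) =>
  (r2v (map_mx (@complex.Re R) r), r2v (map_mx (@complex.Im R) r))).
  move=> [u v] /=; congr (_, _); rewrite -[RHS]v2rK; congr r2v;
    by apply/rowP => j; rewrite !mxE.
by move=> r; apply/rowP => j; rewrite !mxE /= !r2vK !mxE; case: (r 0 j).
Qed.

HB.instance Definition _ :=
  Lmodule_hasFinDim.Build R[i] complexification complexification_vect_iso.

Definition complexify_map (N : V -> V) (w : complexification) :
    complexification :=
  (N w.1, N w.2).

Definition complexify_bracket (br : V -> V -> V) (w z : complexification) :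
    complexification :=
  (br w.1 z.1 - br w.2 z.2, br w.1 z.2 + br w.2 z.1).

End Complexification.

Section GeneralLinear.
Variables (K : fieldType) (n : nat).
Implicit Types (x y : 'M[K]_n) (lambda : 'I_n -> K).

Definition commutator x y : 'M[K]_n := x *m y - y *m x.

Definition left_mul (A x : 'M[K]_n) : 'M[K]_n := A *m x.

Definition diag lambda : 'M[K]_n := diag_mx (\row_i lambda i).

Let addmxE (x y : 'M[K]_n) i j : (x + y) i j = x i j + y i j.
Proof. by rewrite mxE. Qed.
Let oppmxE (x : 'M[K]_n) i j : (- x) i j = - x i j.
Proof. by rewrite mxE. Qed.
Let scalemxE a (x : 'M[K]_n) i j : (a *: x) i j = a * x i j.
Proof. by rewrite mxE. Qed.

Let zeromxE i j : (0 : 'M[K]_n) i j = 0.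
Proof. by rewrite mxE. Qed.

Local Ltac by_expansion :=
  rewrite ?(mulmxDl, mulmxDr, mulmxN, mulNmx, mulmxA);
  rewrite -?(scalemxAl, scalemxAr);
  apply/matrixP => i j; rewrite ?(zeromxE, addmxE, oppmxE, scalemxE); ring.

Lemma commutator_is_lie_bracket : is_lie_bracket commutator.
Proof.
rewrite /commutator; split=> [x a y z|y a x z|x|x y z].
- by_expansion.
- by_expansion.
- exact: subrr.
- by_expansion.
Qed.

Lemma left_mul_nijenhuis A : nijenhuis commutator (left_mul A).
Proof.
rewrite /commutator /left_mul; split=> [a x y|x y]; first by_expansion.
by_expansion.
Qed.

Lemma deformed_bracket_left_mul A x y :
  deformed_bracket commutator (left_mul A) x y = x *m A *m y - y *m A *m x.
Proof. by rewrite /deformed_bracket /commutator /left_mul; by_expansion. Qed.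

End GeneralLinear.

(* Main.v *)
Require Import Defs.
From HB Require Import structures.
From mathcomp Require Import all_boot all_order all_algebra.
From mathcomp Require Import perm complex.
From mathcomp Require Import all_classical all_reals.
From mathcomp Require Import topology normedtype.
From mathcomp Require Import zify.

Set Implicit Arguments.
Unset Strict Implicit.
Unset Printing Implicit Defensive.

Import Order.TTheory GRing.Theory Num.Theory numFieldNormedType.Exports.
Local Open Scope ring_scope.

(** Identify the dual of [gl_n] with matrices by the trace pairing: a covector
    is [x |-> tr (M x)].  At the point [M], the member [s] of the pencil is the
    form [(x, y) |-> tr ((M x B - B x M) y)] with [B = s1 + s2 A], so that its
    kernel is the space of the matrices [x] with [M x B = B x M].  The pencil is
    Kronecker at [M] as soon as this kernel has dimension exactly [n] for all
    nonzero [s], and this is what happens for generic [M].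

    At least [n]: if [M] is invertible, the kernel is isomorphic to the
    commutant of [C = M^-1 B].  In a basis where [C] is triangular, the bracket
    with [C] sends triangular matrices to strictly triangular ones, which
    loses [n] dimensions ([pencil_kernel_dim]).

    At most [n]: let [M] be the shift matrix.  The equation [M x B = B x M] is
    then a two-term recurrence along the diagonals of [x].  As the [lambda i]
    are distinct, at most one diagonal entry of [B] vanishes when [s != 0];
    therefore [x] is determined by [n] well-chosen entries ([dim_shift_kernel]).

    It remains to pass from the shift matrix to generic [M], uniformly in [s].
    For [s = (t, 1)], each Gram minor of the form is a polynomial in [t] whose
    coefficients are polynomials in [M].  At the shift matrix, some minor [p]
    has maximal degree and some combination [q] of minors has no common root
    with it.  Elimination gives a polynomial in [M] whose non-vanishing
    preserves these two facts ([generic_no_common_root],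
    [generic_full_gram]).  Finally the locus where a nonzero polynomial
    function does not vanish is open and dense ([polyfun_open],
    [polyfun_dense]).

    All this is done over an abstract space [g] with a linear isomorphism to
    matrices that is compatible with the bracket and the operator
    ([kronecker_gl]), which covers both [gl_n(C)] and the complexification of
    [gl_n(R)]. *)

(** * Polynomial functions on the dual space *)

Section PolynomialFunctions.
Variables (C : numFieldType) (g : vectType C).

(** Only evaluations at vectors are taken as generators: they are continuous
    for the topology of the dual, and affine along lines. *)
Inductive polyfun : (dual g -> C) -> Prop :=
  | polyfun_cst c : polyfun (fun=> c)
  | polyfun_ev v : polyfun (fun xi => (xi : 'Hom(g, C^o)) v)
  | polyfunD f h : polyfun f -> polyfun h -> polyfun (fun xi => f xi + h xi)
  | polyfunM f h : polyfun f -> polyfun h -> polyfun (fun xi => f xi * h xi).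

Lemma polyfun_sum I (r : seq I) (P : pred I) (f : I -> dual g -> C) :
  (forall i, polyfun (f i)) -> polyfun (fun xi => \sum_(i <- r | P i) f i xi).
Proof.
move=> pf; elim: r => [|i r IHr].
  by under boolp.eq_fun do rewrite big_nil; exact: polyfun_cst.
under boolp.eq_fun do rewrite big_cons.
by case: (P i) => //; apply: polyfunD.
Qed.

Lemma polyfun_prod I (r : seq I) (P : pred I) (f : I -> dual g -> C) :
  (forall i, polyfun (f i)) -> polyfun (fun xi => \prod_(i <- r | P i) f i xi).
Proof.
move=> pf; elim: r => [|i r IHr].
  by under boolp.eq_fun do rewrite big_nil; exact: polyfun_cst.
under boolp.eq_fun do rewrite big_cons.
by case: (P i) => //; apply: polyfunM.
Qed.

Lemma polyfun_det m (A : dual g -> 'M[C]_m) :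
  (forall i j, polyfun (fun xi => A xi i j)) -> polyfun (fun xi => \det (A xi)).
Proof.
move=> pA; apply: polyfun_sum => s; apply: polyfunM; first exact: polyfun_cst.
by apply: polyfun_prod => i; exact: pA.
Qed.

Lemma ev_continuous (v : g) :
  continuous (fun xi : dual g => (xi : 'Hom(g, C^o)) v : C).
Proof.
move=> xi.
have ci := @initial_continuous _ _
  (fun xi : 'Hom(g, C^o) => (xi : {ptws g -> C})).
exact: (cvg_comp _ (@proj g (fun=> C) v) (ci xi)
  (@proj_continuous g (fun=> C) v _)).
Qed.

Lemma polyfun_continuous f : polyfun f -> continuous f.
Proof.
elim=> [c|v|{}f h _ cf _ ch|{}f h _ cf _ ch] xi.
- exact: cst_continuous.
- exact: ev_continuous.
- exact: cvgD (cf xi) (ch xi).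
- exact: cvgM (cf xi) (ch xi).
Qed.

Lemma polyfun_line f (xi eta : 'Hom(g, C^o)) : polyfun f ->
  exists p : {poly C}, forall t, f (xi + t *: eta : 'Hom(g, C^o)) = p.[t].
Proof.
elim=> [c|v|{}f h _ [p fp] _ [q hq]|{}f h _ [p fp] _ [q hq]].
- by exists c%:P => t; rewrite hornerC.
- exists ((xi v)%:P + (eta v : C) *: 'X) => t.
  by rewrite add_lfunE scale_lfunE !hornerE mulrC.
- by exists (p + q) => t; rewrite hornerD fp hq.
- by exists (p * q) => t; rewrite hornerM fp hq.
Qed.

Lemma affine_continuous (a b : C) : continuous (fun t : C => a + t * b).
Proof.
move=> t.
have h1 : {for t, continuous (fun _ : C => a)} by exact: cst_continuous.
have h2 : {for t, continuous (fun _ : C => b)} by exact: cst_continuous.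
have h3 : {for t, continuous (fun u : C => u)} by [].
exact: cvgD h1 (cvgM h3 h2).
Qed.

Lemma line_continuous (xi eta : 'Hom(g, C^o)) :
  continuous (fun t : C => (xi + t *: eta : 'Hom(g, C^o)) : dual g).
Proof.
apply: continuous_comp_initial => t; 
apply/(@cvg_sup _ _ _ _ _ (fmap_filter _ (nbhs_filter t))) => v.
apply: (@continuous_comp_initial _ _ _ (fun h : g -> C => h v)) => {}t.
set F := (X in continuous_at _ X).
have -> : F = (fun t : C => (xi v : C) + t * (eta v : C)).
  by apply/funext => u; rewrite /F /= add_lfunE scale_lfunE.
exact: affine_continuous.
Qed.

(** The points [e / (k + 2)] of a ball of radius [e] are more numerous than the
    roots of [p]. *)
Lemma nonroot_near0 (p : {poly C}) (A : set C) :
  p != 0 -> nbhs (0 : C) A -> exists2 t, A t & p.[t] != 0.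
Proof.
move=> p0 /nbhs_ballP[e /= e0 eA].
pose s := [seq e / k.+2%:R | k <- iota 0 (size p)].
have us : uniq s.
  rewrite map_inj_uniq ?iota_uniq// => j k.
  move=> /(mulfI (lt0r_neq0 e0))/invr_inj/eqP.
  by rewrite eqr_nat !eqSS => /eqP.
have: ~~ all (root p) s.
  apply/negP => ps; have := max_poly_roots p0 ps us.
  by rewrite size_map size_iota ltnn.
case/allPn => _ /mapP[k _ ->] pk; exists (e / k.+2%:R) => //; apply: eA.
rewrite /ball /= sub0r normrN ger0_norm ?divr_ge0 ?ler0n ?ltW//.
by rewrite ltr_pdivrMr ?ltr0n// ltr_pMr// ltr1n.
Qed.

Lemma polyfun_open f : polyfun f -> open [set xi | f xi != 0]%classic.
Proof.
move=> /polyfun_continuous cf; rewrite openE => xi /= f0.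
exact: cvgr_neq0 (cf xi) f0.
Qed.

(** On the line from any point [xi] to [xi0], the function is a polynomial in
    one variable that is nonzero at [1]; hence it is nonzero arbitrarily close
    to [xi]. *)
Lemma polyfun_dense f xi0 :
  polyfun f -> f xi0 != 0 -> dense [set xi | f xi != 0]%classic.
Proof.
move=> pf f0 O [xi Oxi] oO.
have [p fp] := polyfun_line xi ((xi0 : 'Hom(g, C^o)) - xi) pf.
have p0 : p != 0.
  apply: contraNneq f0 => p0.
  by have := fp 1; rewrite p0 horner0 scale1r addrC subrK => ->.
pose line t : dual g := (xi + t *: ((xi0 : 'Hom(g, C^o)) - xi) : 'Hom(g, C^o)).
have [|t Ot pt] := nonroot_near0 (A := (line @^-1` O)%classic) p0.
  apply: line_continuous; apply: open_nbhs_nbhs; split => //.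
  by rewrite /line scale0r addr0.
exists (line t).
by split => //=; rewrite fp.
Qed.

End PolynomialFunctions.

(** * Elimination for one-parameter families of polynomials *)

Section AffinePencils.
Variable C : numClosedFieldType.

Lemma prod_affine r (a b : 'I_r -> C) (p := \prod_i (a i *: 'X + (b i)%:P)) :
  (size p <= r.+1)%N /\ p`_r = \prod_i a i.
Proof.
rewrite {}/p; elim: r a b => [|r IHr] a b.
  by rewrite !big_ord0 coefC size_poly1.
have [] := IHr (a \o widen_ord (leqnSn r)) (b \o widen_ord (leqnSn r)).
rewrite !big_ord_recr /=; set p := \prod_(i < r) (_ *: _ + _) => sz_p lead_p.
rewrite mulrDr -scalerAr (mulrC p (b _)%:P) mul_polyC; split.
  apply: leq_trans (size_polyD _ _) _; rewrite geq_max.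
  rewrite !(leq_trans (size_scale_leq _ _))// ?(leqW sz_p)//.
  by rewrite (leq_trans (size_polyMleq _ _))// size_polyX addn2.
rewrite coefD !coefZ coefMX /= lead_p mulrC.
by rewrite (nth_default _ sz_p) mulr0 addr0.
Qed.

Definition pencil_det r (P Q : 'M[C]_r) : {poly C} :=
  \det (\matrix_(i, j) (P i j *: 'X + (Q i j)%:P)).

Lemma size_pencil_det r (P Q : 'M[C]_r) : (size (pencil_det P Q) <= r.+1)%N.
Proof.
apply: leq_trans (size_sum _ _ _) _; apply/bigmax_leqP => s _.
rewrite -polyC1 -polyCN -polyC_exp mul_polyC (leq_trans (size_scale_leq _ _))//.
under eq_bigr do rewrite mxE.
by have [] := prod_affine (fun i => P i (s i)) (fun i => Q i (s i)).
Qed.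

Lemma coef_pencil_det r (P Q : 'M[C]_r) : (pencil_det P Q)`_r = \det P.
Proof.
rewrite /pencil_det coef_sum; apply: eq_bigr => s _.
rewrite -polyC1 -polyCN -polyC_exp coefCM; congr (_ * _).
under eq_bigr do rewrite mxE.
by have [] := prod_affine (fun i => P i (s i)) (fun i => Q i (s i)).
Qed.

Lemma horner_pencil_det r (P Q : 'M[C]_r) t :
  (pencil_det P Q).[t] = \det (t *: P + Q).
Proof.
rewrite -[LHS]/(horner_eval t _) -det_map_mx; congr (\det _); apply/matrixP => i j.
by rewrite !mxE /= /horner_eval !hornerE mulrC.
Qed.

Variable g : vectType C.

(** A uniform bound on the degree is part of the notion: the matrix of
    coefficients used for elimination must have a fixed size. *)
Definition polyfam (f : dual g -> {poly C}) :=
  (forall k, polyfun (fun xi => (f xi)`_k)) /\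
  exists e, forall xi, (size (f xi) <= e)%N.

Lemma polyfam_cst p : polyfam (fun=> p).
Proof. by split=> [k|]; [exact: polyfun_cst | exists (size p)]. Qed.

Lemma polyfamD f h : polyfam f -> polyfam h -> polyfam (fun xi => f xi + h xi).
Proof.
move=> [pf [d fd]] [ph [e he]]; split=> [k|].
  by under boolp.eq_fun do rewrite coefD; exact: polyfunD.
exists (maxn d e) => xi; rewrite (leq_trans (size_polyD _ _))// geq_max.
by rewrite !leq_max fd he orbT.
Qed.

Lemma polyfamM f h : polyfam f -> polyfam h -> polyfam (fun xi => f xi * h xi).
Proof.
move=> [pf [d fd]] [ph [e he]]; split=> [k|].
  under boolp.eq_fun do rewrite coefM.
  by apply: polyfun_sum => i; exact: polyfunM.
exists (d + e)%N => xi; rewrite (leq_trans (size_polyMleq _ _))//.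
by rewrite (leq_trans (leq_pred _))// leq_add.
Qed.

Lemma polyfam_sum I (r : seq I) (P : pred I) (f : I -> dual g -> {poly C}) :
  (forall i, polyfam (f i)) -> polyfam (fun xi => \sum_(i <- r | P i) f i xi).
Proof.
move=> pf; elim: r => [|i r IHr].
  by under boolp.eq_fun do rewrite big_nil; exact: polyfam_cst.
under boolp.eq_fun do rewrite big_cons.
by case: (P i) => //; apply: polyfamD.
Qed.

Lemma polyfam_prod I (r : seq I) (P : pred I) (f : I -> dual g -> {poly C}) :
  (forall i, polyfam (f i)) -> polyfam (fun xi => \prod_(i <- r | P i) f i xi).
Proof.
move=> pf; elim: r => [|i r IHr].
  by under boolp.eq_fun do rewrite big_nil; exact: polyfam_cst.
under boolp.eq_fun do rewrite big_cons.
by case: (P i) => //; apply: polyfamM.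
Qed.

Lemma polyfam_pencil_det r (P Q : dual g -> 'M[C]_r) :
  (forall i j, polyfun (fun xi => P xi i j)) ->
  (forall i j, polyfun (fun xi => Q xi i j)) ->
  polyfam (fun xi => pencil_det (P xi) (Q xi)).
Proof.
move=> pP pQ; apply: polyfam_sum => s; apply: polyfamM; first exact: polyfam_cst.
apply: polyfam_prod => i; under boolp.eq_fun do rewrite mxE.
split=> [k|]; last first.
  exists 2 => xi; rewrite (leq_trans (size_polyD _ _))// geq_max.
  rewrite (leq_trans (size_scale_leq _ _)) ?size_polyX//.
  by rewrite (leq_trans (size_polyC_leq1 _)).
under boolp.eq_fun do rewrite coefD coefZ coefC.
apply: polyfunD; first by apply: polyfunM => //; exact: polyfun_cst.
by case: (k == 0)%N; [exact: pQ | exact: polyfun_cst].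
Qed.

(** The function [F] is a substitute for the resultant of [p] and [q].  At [xi0],
    Bezout's identity expresses every monomial ['X^k], [k < D], as
    [a k * p xi0 + b k * q xi0].  Keeping [a] and [b] fixed and letting [xi] vary,
    [F xi] is the determinant of the coefficients of the polynomials
    [a k * p xi + b k * q xi]; it is [1] at [xi0].  If [t] is a common root at
    [xi], then all these polynomials vanish at [t], and the vector of the
    powers of [t] is in the kernel of the matrix. *)
Lemma generic_no_common_root d (p q : dual g -> {poly C}) xi0 :
  polyfam p -> polyfam q -> (forall xi, size (p xi) <= d.+1)%N ->
  size (p xi0) = d.+1 -> coprimep (p xi0) (q xi0) ->
  exists F, [/\ polyfun F, F xi0 != 0 & forall xi, F xi != 0 ->
    forall t, root (p xi) t -> ~~ root (q xi) t].
Proof.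
move=> pp pq szp szp0 /Bezout_eq1_coprimepP[[u v] /= uv1].
have p0 : p xi0 != 0 by rewrite -size_poly_eq0 szp0.
have [_ [e sze]] := pq.
pose D := (d + e).+1.
(* Reducing the cofactor of q modulo p xi0 keeps all degrees below D; this is
   where the exact degree of p xi0 matters. *)
pose a k := 'X^k * u + ('X^k * v) %/ p xi0 * q xi0.
pose b k := ('X^k * v) %% p xi0.
pose f k xi := a k * p xi + b k * q xi.
have f0 k : f k xi0 = 'X^k.
  rewrite /f mulrDl -addrA -[_ %/ _ * _ * _]mulrAC -mulrDl /b -divp_eq.
  by rewrite -!mulrA -mulrDr uv1 mulr1.
have szb k : (size (b k) <= d)%N.
  by rewrite -ltnS -szp0 ltn_modp.
have szbq k xi : (size (b k * q xi)%R <= D)%N.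
  rewrite (leq_trans (size_polyMleq _ _))// -subn1 leq_subLR.
  by rewrite /D (leq_trans (leq_add (szb k) (sze xi)))// add1n !leqW.
have sza k : (k < D)%N -> (size (a k) <= D - d)%N.
  move=> kD; have [->|a0] := eqVneq (a k) 0; first by rewrite size_poly0.
  have: (size (a k * p xi0)%R <= D)%N.
    have -> : a k * p xi0 = 'X^k - b k * q xi0 by rewrite -(f0 k) addrK.
    rewrite (leq_trans (size_polyD _ _))// size_polyN geq_max szbq andbT.
    by rewrite size_polyXn.
  by rewrite size_mul// szp0 addnS /= addnC -leq_subRL// /D -addnS leq_addr.
have szf k xi : (k < D)%N -> (size (f k xi) <= D)%N.
  move=> kD; rewrite (leq_trans (size_polyD _ _))// geq_max szbq andbT.
  rewrite (leq_trans (size_polyMleq _ _))// -subn1 leq_subLR.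
  rewrite (leq_trans (leq_add (sza k kD) (szp xi)))// addnS subnK//.
  by rewrite /D -addnS leq_addr.
pose M xi := \matrix_(k < D, j < D) (f k xi)`_j.
exists (fun xi => \det (M xi)); split.
- apply: polyfun_det => k j; under boolp.eq_fun do rewrite mxE.
  by apply: (polyfamD (polyfamM (polyfam_cst _) pp) (polyfamM (polyfam_cst _) pq)).1.
- have -> : M xi0 = 1%:M.
    by apply/matrixP => k j; rewrite !mxE f0 coefXn eq_sym.
  by rewrite det1 oner_neq0.
move=> xi; rewrite -unitfE -unitmxE => uM t pt; apply/negP => qt.
pose w : 'cV[C]_D := \col_j t ^+ j.
have: M xi *m w = 0.
  apply/colP => k; rewrite !mxE.
  under eq_bigr do rewrite !mxE.
  rewrite -horner_coef_wide ?szf// hornerD !hornerM.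
  by rewrite (rootP pt) (rootP qt) !mulr0 addr0.
move/(congr1 (mulmx (invmx (M xi)))); rewrite mulmxA mulVmx// mul1mx mulmx0.
move/colP/(_ ord0)/eqP; rewrite !mxE expr0.
by rewrite oner_eq0.
Qed.

End AffinePencils.

(** * Rank of a bilinear form *)

Definition gram (C : numFieldType) (g : vectType C) r
    (b : g -> g -> C) (x y : 'I_r -> g) : 'M[C]_r :=
  \matrix_(i, j) b (x i) (y j).

Section BivectorRank.
Variables (C : numFieldType) (g : vectType C) (b : g -> g -> C).

Lemma linfun_linearE (U V : vectType C) (f : U -> V) :
  linear f -> linfun f =1 f.
Proof.
move=> lf; pose F : {linear U -> V} :=
  HB.pack f (GRing.isLinear.Build _ _ _ _ f lf).
exact: (lfunE F).
Qed.

Definition bivector_map : 'Hom(g, 'Hom(g, C^o)) :=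
  linfun (fun x : g => linfun (b x : g -> C^o) : 'Hom(g, C^o)).

Hypothesis linr : forall x, linear (b x : g -> C^o).
Hypothesis linl : forall y, linear (b^~ y : g -> C^o).

Lemma bivector_mapE x y : bivector_map x y = b x y.
Proof.
rewrite linfun_linearE ?linfun_linearE// => a u v; apply/lfunP => z.
by rewrite add_lfunE scale_lfunE !linfun_linearE// linl.
Qed.

Lemma bivector_rank_ker :
  (\dim (lker bivector_map) + bivector_rank b)%N = \dim {: g}.
Proof. by rewrite -(limg_ker_dim bivector_map fullv) capfv. Qed.

Lemma mem_lker_bivector_map x :
  (x \in lker bivector_map) = `[< forall y, b x y = 0 >].
Proof.
rewrite memv_ker; apply/eqP/boolp.asboolP => [x0 y|x0].
  by rewrite -bivector_mapE x0 zero_lfunE.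
by apply/lfunP => y; rewrite bivector_mapE x0 zero_lfunE.
Qed.

Lemma leq_bivector_rank r (x y : 'I_r -> g) :
  \det (gram b x y) != 0 -> (r <= bivector_rank b)%N.
Proof.
rewrite -unitfE -unitmxE => uG.
have fX : free [tuple bivector_map (x i) | i < r].
  apply/freeP => k; under eq_bigr do rewrite nth_mktuple.
  move=> /lfunP k0; pose v : 'rV[C]_r := \row_i k i.
  suff : v = 0 by move=> /rowP v0 i; have := v0 i; rewrite !mxE.
  suff vG : v *m gram b x y = 0 by rewrite -(mulmxK uG v) vG mul0mx.
  apply/rowP => j; have := k0 (y j).
  rewrite sum_lfunE zero_lfunE !mxE => {2}<-; apply: eq_bigr => i _.
  by rewrite !mxE scale_lfunE bivector_mapE.
rewrite /bivector_rank -/bivector_map.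
rewrite -(size_tuple [tuple bivector_map (x i) | i < r]).
rewrite -(eqnP fX) dimvS//; apply/span_subvP => _ /mapP[i _ ->].
exact: memv_img (memvf _).
Qed.

(** Independent functionals in the image of the form have a matrix of values on
    a basis with independent rows, and a right inverse of this matrix gives the
    vectors [y]. *)
Lemma bivector_rank_gram r : (r <= bivector_rank b)%N ->
  exists x y : 'I_r -> g, \det (gram b x y) != 0.
Proof.
move=> r_le; set V := limg bivector_map.
pose s := take r (vbasis V).
have ss : size s == r by rewrite size_takel // size_tuple.
have fs : free (Tuple ss).
  have := basis_free (vbasisP V).
  by rewrite -[X in free X](cat_take_drop r) => /catl_free.
have /boolp.choice[x xP] (i : 'I_r) : exists u, s`_i = bivector_map u.
  have /memv_imgP[u _ ->] : s`_i \in V by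
    apply/vbasis_mem/(@mem_take r)/mem_nth; rewrite (eqP ss).
  by exists u.
pose e := vbasis {: g}.
pose Psi := \matrix_(i < r, k < \dim {: g}) b (x i) e`_k.
have /row_freeP[Y PsiY] : row_free Psi.
  apply: inj_row_free => v vPsi; apply/rowP => i; rewrite mxE.
  move/freeP : fs => /(_ (v 0)) -> //; apply/lfunP => u.
  rewrite sum_lfunE zero_lfunE (coord_vbasis (memvf u)).
  under eq_bigr do rewrite /= linear_sum.
  rewrite exchange_big big1//= => k _.
  under eq_bigr do rewrite linearZ /= scale_lfunE xP bivector_mapE.
  rewrite -scaler_sumr; have /rowP/(_ k) := vPsi.
  by rewrite !mxE; under eq_bigr do rewrite mxE; move=> ->; rewrite scaler0.
exists x, (fun j => \sum_k Y k j *: e`_k).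
have -> : gram b x (fun j => \sum_k Y k j *: e`_k) = 1%:M.
  rewrite -PsiY; apply/matrixP => i j; rewrite !mxE -bivector_mapE linear_sum.
  by apply: eq_bigr => k _; rewrite linearZ /= bivector_mapE mxE mulrC.
by rewrite det1 oner_neq0.
Qed.

End BivectorRank.

(** * Genericity of the rank of a pencil *)

Section GenericGram.
Variables (C : numClosedFieldType) (g : vectType C).
Variables (br : g -> g -> g) (N : g -> g).

Definition gram_poly r (x y : 'I_r -> g) (xi : dual g) : {poly C} :=
  pencil_det (gram (lie_poisson br xi) x y)
             (gram (lie_poisson (deformed_bracket br N) xi) x y).

Lemma polyfun_gram r b (x y : 'I_r -> g) i j :
  polyfun (fun xi : dual g => gram (lie_poisson b xi) x y i j).
Proof. by under boolp.eq_fun do rewrite mxE; exact: polyfun_ev. Qed.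

Lemma polyfam_gram_poly r (x y : 'I_r -> g) : polyfam (gram_poly x y).
Proof. by apply: polyfam_pencil_det => i j; exact: polyfun_gram. Qed.

Lemma det_gram_scale r (x y : 'I_r -> g) xi c (s : C * C) :
  \det (gram (poisson_pencil br N (c * s.1, c * s.2) xi) x y) =
  c ^+ r * \det (gram (poisson_pencil br N s xi) x y).
Proof.
rewrite -detZ; congr (\det _); apply/matrixP => i j.
by rewrite !mxE /poisson_pencil /= mulrDr !mulrA.
Qed.

Lemma horner_gram_poly r (x y : 'I_r -> g) xi t :
  (gram_poly x y xi).[t] = \det (gram (poisson_pencil br N (t, 1) xi) x y).
Proof.
rewrite horner_pencil_det; congr (\det _); apply/matrixP => i j.
by rewrite !mxE /poisson_pencil /= mul1r.
Qed.

Lemma coef_gram_poly r (x y : 'I_r -> g) xi :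
  (gram_poly x y xi)`_r = \det (gram (poisson_pencil br N (1, 0) xi) x y).
Proof.
rewrite coef_pencil_det; congr (\det _); apply/matrixP => i j.
by rewrite !mxE /poisson_pencil /= mul1r mul0r addr0.
Qed.

(** This says that the rank is at least [r] for every nonzero [s], in a form to
    which elimination applies; the vectors may depend on [s]. *)
Definition full_gram r (xi : dual g) := forall s : C * C, s != 0 ->
  exists x y : 'I_r -> g, \det (gram (poisson_pencil br N s xi) x y) != 0.

(** The minor [p] is chosen nonzero at [xi0] for [s = (1, 0)], that is, of degree
    exactly [r] in [t].  For each of its finitely many roots [t], some minor does
    not vanish there; the combination [q] of these minors by Lagrange
    polynomials [c t] vanishes at none of the roots.  Up to scaling, a nonzero
    [s] is [(1, 0)] or [(t, 1)], and the factor [det] in the final function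
    takes care of the former. *)
Lemma generic_full_gram r xi0 : full_gram r xi0 ->
  exists F, [/\ polyfun F, F xi0 != 0 & forall xi, F xi != 0 -> full_gram r xi].
Proof.
move=> full0.
have [|x [y xy0]] := full0 (1, 0).
  by apply/eqP => -[] /eqP; rewrite oner_eq0.
have /boolp.choice[z zP] : forall t, exists z : ('I_r -> g) * ('I_r -> g),
    (gram_poly z.1 z.2 xi0).[t] != 0.
  move=> t; have [|u [v uv0]] := full0 (t, 1).
    by apply/eqP => -[] _ /eqP; rewrite oner_eq0.
  by exists (u, v); rewrite horner_gram_poly.
pose p := gram_poly x y.
have szp : size (p xi0) = r.+1.
  apply/eqP; rewrite eqn_leq size_pencil_det /= ltnNge; apply: contraNN xy0.
  by move=> szp; rewrite -coef_gram_poly nth_default.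
have p0 : p xi0 != 0 by rewrite -size_poly_eq0 szp.
have [rs0 prs0] := closed_field_poly_normal (p xi0).
pose rs := undup rs0.
have prs t : root (p xi0) t -> t \in rs.
  by rewrite prs0 rootZ ?lead_coef_eq0// root_prod_XsubC mem_undup.
pose c t := \prod_(u <- rs | u != t) ('X - u%:P).
pose q xi := \sum_(t <- rs) c t * gram_poly (z t).1 (z t).2 xi.
have pq : polyfam q.
  apply: polyfam_sum => t; apply: polyfamM; first exact: polyfam_cst.
  exact: polyfam_gram_poly.
have copq : coprimep (p xi0) (q xi0).
  apply: Pdiv.ClosedField.root_coprimep => t /prs trs.
  rewrite /q horner_sum (bigD1_seq t) ?undup_uniq//= big1 ?addr0; last first.
    move=> u ut; apply/eqP; rewrite hornerM mulf_eq0 horner_prod.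
    rewrite prodf_seq_eq0; apply/orP; left; apply/hasP; exists t => //.
    by rewrite eq_sym ut hornerXsubC subrr eqxx.
  rewrite hornerM mulf_neq0// /c horner_prod prodf_seq_neq0.
  apply/allP => u urs; apply/implyP => ut.
  by rewrite hornerXsubC subr_eq0 eq_sym.
have [F [pF F0 FP]] := generic_no_common_root
  (polyfam_gram_poly x y) pq (fun xi => size_pencil_det _ _) szp copq.
exists (fun xi => F xi * \det (gram (poisson_pencil br N (1, 0) xi) x y)); split.
- apply: polyfunM => //; under boolp.eq_fun do rewrite -coef_gram_poly.
  exact: (polyfam_gram_poly x y).1.
- by rewrite mulf_neq0.
move=> xi; rewrite mulf_eq0 negb_or => /andP[/FP Fxi xyxi] [s1 s2].
have [->|s2_neq0 _] := eqVneq s2 0.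
  move=> s_neq0; have s1_neq0 : s1 != 0.
    by apply: contraNneq s_neq0 => ->.
  exists x, y; have -> : (s1, 0) = (s1 * (1, 0 : C).1, s1 * (1 : C, 0).2) :> C * C.
    by rewrite /= mulr1 mulr0.
  by rewrite det_gram_scale mulf_neq0// expf_neq0.
pose t := s1 / s2.
have -> : (s1, s2) = (s2 * (t, 1 : C).1, s2 * (t, 1 : C).2).
  by rewrite /= mulr1 /t mulrC divfK.
suff [u [v uv]] : exists u v : 'I_r -> g, (gram_poly u v xi).[t] != 0.
  exists u, v; rewrite det_gram_scale mulf_neq0 ?expf_neq0//.
  by rewrite -horner_gram_poly.
have [pt|pt] := boolP (root (p xi) t); last by exists x, y.
have := Fxi t pt; rewrite /root /q horner_sum => qt.
have [u _ ut] : exists2 u, u \in rs & (gram_poly (z u).1 (z u).2 xi).[t] != 0.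
  apply/hasP; apply: contraNT qt => /hasPn qt.
  rewrite big_seq big1// => u /qt; rewrite negbK => /eqP ut.
  by rewrite hornerM ut mulr0.
by exists (z u).1, (z u).2.
Qed.

End GenericGram.

(** * The kernel at the shift matrix *)

Lemma diag_mull (K : fieldType) n (b : 'I_n -> K) (x : 'M[K]_n) i j :
  (diag b *m x) i j = b i * x i j.
Proof. by rewrite /diag mul_diag_mx !mxE. Qed.

Lemma diag_mulr (K : fieldType) n (b : 'I_n -> K) (x : 'M[K]_n) i j :
  (x *m diag b) i j = x i j * b j.
Proof. by rewrite /diag mul_mx_diag !mxE. Qed.

Section PencilKernel.
Variable C : numClosedFieldType.

(** The map whose kernel is the kernel of the form
    [(x, y) |-> tr ((M x B - B x M) y)]. *)
Definition pencil_adjoint n (M B : 'M[C]_n) : 'End('M[C]_n) :=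
  linfun ((mulmx M \o mulmxr B) \- (mulmx B \o mulmxr M)).

Lemma pencil_adjointE n (M B x : 'M[C]_n) :
  pencil_adjoint M B x = M *m (x *m B) - B *m (x *m M).
Proof. by rewrite lfunE. Qed.

Definition shift_mx n : 'M[C]_n := \matrix_(i, j) (j == i.+1 :> nat)%:R.

Lemma shift_mxl n (x : 'M[C]_n.+1) i j :
  (shift_mx n.+1 *m x) i j = if (i.+1 < n.+1)%N then x (inord i.+1) j else 0.
Proof.
rewrite mxE; case: ifPn => [i_lt|]; last first.
  rewrite -leqNgt => i_ge; rewrite big1// => l _; rewrite mxE.
  by rewrite ltn_eqF ?mul0r// (leq_trans (ltn_ord l)).
rewrite (bigD1 (inord i.+1))//= mxE inordK// eqxx mul1r big1 ?addr0// => l li.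
rewrite mxE; case: eqP => [lE|]; rewrite ?mul0r//.
by case/eqP: li; apply: val_inj; rewrite /= inordK.
Qed.

Lemma shift_mxr n (x : 'M[C]_n.+1) (i j : 'I_n.+1) :
  (x *m shift_mx n.+1) i j = if (j : nat) is j'.+1 then x i (inord j') else 0.
Proof.
rewrite mxE; case: j => [[|j] j_lt] /=.
  by rewrite big1// => l _; rewrite mxE mulr0.
rewrite (bigD1 (inord j))//= mxE inordK ?(ltnW j_lt)// eqxx mulr1.
rewrite big1 ?addr0// => l lj; rewrite mxE /= eqSS.
case: eqP => [lE|]; rewrite ?mulr0//.
by case/eqP: lj; apply: val_inj; rewrite /= inordK ?lE ?(ltnW j_lt).
Qed.

(** With the convention that entries out of range are zero, the hypothesis says
    [b (j+1) * x (i+1) (j+1) = b i * x i j] along each diagonal, and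
    [b 0 * x (i+1) 0 = 0].  Zeros propagate down a diagonal into every column
    except [k], and up a diagonal into every row except [k].  A strictly
    lower diagonal is preceded and followed by zeros; in any other, a zero is
    prescribed in column [k] or, if it starts to the right of it, in row [0]. *)
Lemma shift_kernel_eq0 n (b : 'I_n.+1 -> C) (k : 'I_n.+1) (x : 'M[C]_n.+1) :
  (forall i, i != k -> b i != 0) ->
  shift_mx n.+1 *m (x *m diag b) = diag b *m (x *m shift_mx n.+1) ->
  (forall j : 'I_n.+1, (j <= k)%N -> x j k = 0) ->
  (forall j : 'I_n.+1, (k < j)%N -> x ord0 j = 0) ->
  x = 0.
Proof.
move=> b_neq0 xE xk x0.
pose X p q := if (p < n.+1)%N && (q < n.+1)%N then x (inord p) (inord q) else 0.
pose beta p := b (inord p).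
have Xout p q : ((n < p) || (n < q))%N -> X p q = 0.
  by move=> H; rewrite /X; case: ifP => //; lia.
have beta_mulI p y : (p < n.+1)%N -> p <> k :> nat -> beta p * y = 0 -> y = 0.
  move=> pn pk /eqP; rewrite mulf_eq0 => /orP[/eqP bp0|/eqP//].
  have /b_neq0 : inord p != k by apply/eqP => pk'; apply: pk; rewrite -pk' inordK.
  by rewrite -/(beta p) bp0 eqxx.
have E i j : (i < n.+1)%N -> (j < n.+1)%N ->
    beta j * X i.+1 j = beta i * (if j is j'.+1 then X i j' else 0).
  move=> i_lt j_lt; have /matrixP/(_ (inord i) (inord j)) := xE.
  rewrite shift_mxl diag_mull shift_mxr diag_mulr !inordK//.
  rewrite /X j_lt i_lt andbT [beta j * _]mulrC.
  case: j j_lt => [|j] j_lt; last rewrite (ltnW j_lt).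
  by case: ifP; rewrite ?mul0r.
  by case: ifP; rewrite ?mul0r.
have E0 i : (i < n.+1)%N -> beta 0 * X i.+1 0 = 0.
  by move=> i_lt; rewrite (E i 0) ?mulr0.
have ES i j : (i < n.+1)%N -> (j.+1 < n.+1)%N ->
    beta j.+1 * X i.+1 j.+1 = beta i * X i j.
  by move=> i_lt j_lt; rewrite (E i j.+1).
have kn := ltn_ord k.
(* Below the diagonal, left of column k: downwards from column 0. *)
have low_left q p : (q < p)%N -> (q < k)%N -> X p q = 0.
  elim: q p => [|q IHq] [|p]// qp qk.
    have [pn|pn] := ltnP p n.+1; last by apply: Xout; lia.
    by apply: (beta_mulI 0%N); [lia|lia|exact: E0].
  have [pn|pn] := ltnP p n.+1; last by apply: Xout; lia.
  by apply: (beta_mulI q.+1); [lia|lia|rewrite ES ?IHq ?mulr0//; lia].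
(* Below the diagonal, under row k: upwards from the last row. *)
have low_right d p q : (p + d = n.+1)%N -> (q < p)%N -> (k < p)%N -> X p q = 0.
  elim: d p q => [|d IHd] p q pd qp kp; first by apply: Xout; lia.
  by apply: (beta_mulI p); [lia|lia|rewrite -ES ?IHd ?mulr0//; lia].
have up_k p : (p <= k)%N -> X p k = 0.
  move=> pk; rewrite /X kn andbT; case: ifP => // pn.
  by rewrite inord_val; apply: xk; rewrite inordK.
(* On and above the diagonal, from column k on: downwards from column k or
   from row 0. *)
have up_right p q : (k <= q)%N -> (p <= q)%N -> X p q = 0.
  elim: p q => [|p IHp] q; rewrite leq_eqVlt => /orP[/eqP<-|kq] pq.
  - exact: up_k.
  - rewrite /X; case: ifP => // /andP[_ qn].
    have -> : inord 0 = ord0 :> 'I_n.+1 by apply: val_inj; rewrite /= inordK.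
    by apply: x0; rewrite inordK.
  - by apply: up_k; lia.
  case: q kq pq => // q kq pq.
  have [qn|qn] := ltnP q.+1 n.+1; last by apply: Xout; lia.
  by apply: (beta_mulI q.+1); [lia|lia|rewrite ES ?IHp ?mulr0//; lia].
(* On and above the diagonal, left of column k: upwards from column k. *)
have up_left d p q : (q + d = k)%N -> (p <= q)%N -> X p q = 0.
  elim: d p q => [|d IHd] p q qd pq; first by apply: up_right; lia.
  by apply: (beta_mulI p); [lia|lia|rewrite -ES ?IHd ?mulr0//; lia].
apply/matrixP => p q; rewrite mxE.
have <- : X p q = x p q by rewrite /X !ltn_ord !inord_val.
have [qp|pq] := ltnP q p.
  have [qk|kq] := ltnP q k; first exact: low_left.
  by apply: (low_right (n.+1 - p)%N); have := ltn_ord p; lia.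
have [qk|kq] := ltnP q k; last exact: up_right.
by apply: (up_left (k - q)%N); lia.
Qed.

Lemma dim_shift_kernel n (b : 'I_n -> C) :
  (forall i j, i != j -> (b i != 0) || (b j != 0)) ->
  (\dim (lker (pencil_adjoint (shift_mx n) (diag b))) <= n)%N.
Proof.
case: n b => [|n] b b_neq0.
  by rewrite (leq_trans (dimvS (subvf _)))// dimvf.
have [k kP] : exists k, forall i, i != k -> b i != 0.
  have [[k bk]|nk] := boolp.pselect (exists k, b k = 0).
    by exists k => i /b_neq0; rewrite bk eqxx orbF.
  by exists ord0 => i _; apply/eqP => bi; apply: nk; exists i.
pose coords : 'M[C]_n.+1 -> 'rV[C]_n.+1 :=
  fun x => \row_j (if (j <= k)%N then x j k else x ord0 j).
have coordsE : linfun coords =1 coords.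
  apply: linfun_linearE => a x y; apply/rowP => j.
  by rewrite !mxE; case: ifP.
set K := lker _.
have /limg_dim_eq <- : (K :&: lker (linfun coords) = 0)%VS.
  apply/eqP; rewrite -subv0; apply/subvP => x.
  rewrite memv_cap !memv_ker pencil_adjointE subr_eq0 coordsE memv0.
  move=> /andP[/eqP xE /eqP/rowP cx0]; apply/eqP.
  apply: (shift_kernel_eq0 kP xE) => j jk; have := cx0 j; rewrite !mxE.
    by rewrite jk.
  by rewrite leqNgt jk.
by rewrite (leq_trans (dimvS (subvf _)))// dimvf /dim /= mul1n.
Qed.

End PencilKernel.

(** * The kernel at an invertible matrix *)

Section CentralizerDimension.
Variable C : numClosedFieldType.

Lemma trigonalize n (A : 'M[C]_n) : exists2 P : 'M[C]_n, P \in unitmx &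
  exists2 T : 'M[C]_n, is_trig_mx T & P *m A = T *m P.
Proof.
case: n A => [|n] A.
  by exists 1%:M; [exact: unitmx1 | exists A];
    [apply/is_trig_mxP => -[] | rewrite mul1mx mulmx1].
have [//|P /unitarymx_unit uP trigA] := Schur A.
exists P => //; exists (conjmx P A) => //.
by apply: similarPp; [exact: stablemx_unit | exact/eqP].
Qed.

Definition strict_upper n : 'End('M[C]_n) :=
  linfun (fun x : 'M[C]_n => \matrix_(i, j) (x i j *+ (i < j)%N)).

Definition diagonal n : 'Hom('M[C]_n, 'rV[C]_n) :=
  linfun (fun x : 'M[C]_n => \row_i x i i).

Lemma mem_lker_strict_upper n (x : 'M[C]_n) :
  (x \in lker (strict_upper n)) = is_trig_mx x.
Proof.
rewrite memv_ker linfun_linearE; last first.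
  by move=> a u v; apply/matrixP => i j; rewrite !mxE mulrnDl mulrnAr.
apply/eqP/is_trig_mxP => [/matrixP x0 i j ij|x0].
  by have := x0 i j; rewrite !mxE ij.
by apply/matrixP => i j; rewrite !mxE; case: ltnP => // /x0.
Qed.

Lemma diagonalE n (x : 'M[C]_n) i : diagonal n x 0 i = x i i.
Proof.
rewrite linfun_linearE ?mxE// => a u v.
by apply/rowP => k; rewrite !mxE.
Qed.

Lemma mulmx_trig n (S T : 'M[C]_n) (i j : 'I_n) : is_trig_mx S -> is_trig_mx T ->
  (i <= j)%N -> (S *m T) i j = S i i * T i i *+ (i == j).
Proof.
move=> /is_trig_mxP St /is_trig_mxP Tt ij; rewrite mxE.
rewrite (bigD1 i)//= big1 ?addr0 => [|l li].
  case: eqVneq => [<-//|ij_neq]; rewrite (Tt i j) ?mulr0//.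
  by rewrite ltn_neqAle ij andbT.
have [il|li'] := ltnP i l; first by rewrite St ?mul0r.
rewrite (Tt l j) ?mulr0// (leq_trans _ ij)//.
by rewrite ltn_neqAle li' andbT.
Qed.

(** The bracket with [T] maps the space [U] of lower triangular matrices to its
    subspace of matrices with zero diagonal, whose dimension is [dim U - n]. *)
Lemma trig_commutant_dim n (T : 'M[C]_n) : is_trig_mx T ->
  (n <= \dim (lker (pencil_adjoint T 1%:M)))%N.
Proof.
move=> trigT; set ad := pencil_adjoint T 1%:M.
pose U := lker (strict_upper n).
have dimU : \dim U = (\dim (U :&: lker (diagonal n)) + n)%N.
  rewrite -(limg_ker_dim (diagonal n) U); congr addn.
  suff -> : (diagonal n @: U = fullv)%VS by rewrite dimvf /dim /= mul1n.
  apply/eqP; rewrite eqEsubv subvf /=; apply/subvP => r _.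
  have -> : r = diagonal n (diag_mx r).
    by apply/rowP => i; rewrite diagonalE mxE eqxx.
  by apply: memv_img; rewrite mem_lker_strict_upper diag_mx_is_trig.
have adU : (ad @: U <= U :&: lker (diagonal n))%VS.
  apply/subvP => _ /memv_imgP[x xU ->].
  rewrite mem_lker_strict_upper in xU.
  have ad0 (i j : 'I_n) : (i <= j)%N -> ad x i j = 0.
    move=> ij; rewrite pencil_adjointE mulmx1 mul1mx mxE [X in _ + X]mxE.
    by rewrite !mulmx_trig// [T i i * _]mulrC subrr.
  rewrite memv_cap mem_lker_strict_upper; apply/andP; split.
    by apply/is_trig_mxP => i j /ltnW; exact: ad0.
  by rewrite memv_ker; apply/eqP/rowP => i; rewrite diagonalE ad0// mxE.
have := limg_ker_dim ad U; rewrite dimU => dims.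
have := dimvS adU; have := dimvS (capvSr U (lker ad)).
by move: dims; set a := \dim (U :&: _); lia.
Qed.

(** If [P] conjugates [M^-1 B] to a triangular [T], then
    [w |-> P^-1 w P M^-1] embeds the commutant of [T] into the kernel. *)
Lemma pencil_kernel_dim n (M B : 'M[C]_n) : M \in unitmx ->
  (n <= \dim (lker (pencil_adjoint M B)))%N.
Proof.
move=> uM; have [P uP [T trigT PT]] := trigonalize (invmx M *m B).
apply: leq_trans (trig_commutant_dim trigT) _.
set K := lker (pencil_adjoint T 1%:M).
pose kappa : 'End('M[C]_n) := linfun (mulmx (invmx P) \o mulmxr (P *m invmx M)).
have kappaE w : kappa w = invmx P *m (w *m (P *m invmx M)) by rewrite lfunE.
have BE : B = M *m (invmx P *m T *m P).
  by rewrite -[_ *m T *m P]mulmxA -PT mulKmx// mulKVmx.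
have /limg_dim_eq <- : (K :&: lker kappa = 0)%VS.
  apply/eqP; rewrite -subv0; apply/subvP => w; rewrite memv_cap memv0 memv_ker.
  move=> /andP[_ /eqP]; rewrite kappaE => /(congr1 (mulmx P)).
  rewrite mulKVmx// mulmx0 mulmxA => /(congr1 (mulmx^~ M)).
  rewrite mulmxKV// mul0mx => /(congr1 (mulmx^~ (invmx P))).
  by rewrite mulmxK// mul0mx => ->.
apply: dimvS; apply/subvP => _ /memv_imgP[w wK ->].
move: wK; rewrite !memv_ker !pencil_adjointE mulmx1 mul1mx subr_eq0 => /eqP wK.
rewrite kappaE BE -!mulmxA !(mulKmx uM, mulKVmx uP, mulVmx uM, mulmx1).
by rewrite [w *m (T *m _)]mulmxA -wK -!mulmxA subrr.
Qed.

End CentralizerDimension.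

(** * The pencil of a bracket isomorphic to that of matrices *)

Section KroneckerPencil.
Variables (C : numClosedFieldType) (n : nat) (g : vectType C).
Variables (phi : {linear g -> 'M[C]_n}) (psi : 'M[C]_n -> g).
Hypotheses (phiK : cancel phi psi) (psiK : cancel psi phi).
Variables (br : g -> g -> g) (N : g -> g) (lambda : 'I_n -> C).
Hypothesis phi_br : forall x y, phi (br x y) = commutator (phi x) (phi y).
Hypothesis phi_N : forall x, phi (N x) = left_mul (diag lambda) (phi x).
Hypothesis lambda_inj : forall i j, i != j -> lambda i != lambda j.

(** The indices of [delta_mx] are exchanged because the pairing is
    [tr (M x)]. *)
Definition dual_mx (xi : dual g) : 'M[C]_n :=
  \matrix_(i, j) (xi : 'Hom(g, C^o)) (psi (delta_mx j i)).

Definition trace_form (M : 'M[C]_n) : dual g :=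
  linfun (fun x : g => \tr (M *m phi x) : C^o).

Lemma mxtrace_mul_delta (Z : 'M[C]_n) i j : \tr (Z *m delta_mx j i) = Z i j.
Proof.
rewrite /mxtrace (bigD1 i)//= big1 ?addr0 => [|k ki]; rewrite mxE.
  rewrite (bigD1 j)//= big1 ?addr0 => [|l lj].
    by rewrite mxE !eqxx mulr1.
  by rewrite mxE (negPf lj) mulr0.
by rewrite big1// => l _; rewrite mxE (negPf ki) andbF mulr0.
Qed.

Lemma trace_formE M x : (trace_form M : 'Hom(g, C^o)) x = \tr (M *m phi x).
Proof.
rewrite linfun_linearE// => a u v.
by rewrite linearP mulmxDr -scalemxAr mxtraceD mxtraceZ.
Qed.

Lemma dual_mxK xi : trace_form (dual_mx xi) = xi.
Proof.
apply/lfunP => x; rewrite trace_formE.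
have lpsi : linear psi by apply: (can2_linear phiK psiK).
have [psi' psi'E] : exists psi' : {linear 'M[C]_n -> g}, psi' =1 psi.
  pose psi' : {linear 'M[C]_n -> g} :=
    HB.pack psi (GRing.isLinear.Build _ _ _ _ psi lpsi).
  by exists psi'.
rewrite -[in RHS](phiK x) -psi'E [in RHS](matrix_sum_delta (phi x)) !linear_sum.
rewrite /mxtrace; under eq_bigr do rewrite mxE.
rewrite exchange_big /=; apply: eq_bigr => j _.
rewrite !linear_sum; apply: eq_bigr => i _.
by rewrite mxE !linearZ /= psi'E mulrC.
Qed.

Lemma trace_formK M : dual_mx (trace_form M) = M.
Proof.
by apply/matrixP => i j; rewrite mxE trace_formE psiK mxtrace_mul_delta.
Qed.

Definition pencil_diag (s : C * C) : 'M[C]_n :=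
  diag (fun i => s.1 + s.2 * lambda i).

Lemma pencil_diagE s : pencil_diag s = s.1%:M + s.2 *: diag lambda.
Proof.
apply/matrixP => i j; rewrite !mxE; case: eqP => [->|_].
  by rewrite !mulr1n.
by rewrite !mulr0n mulr0 addr0.
Qed.

Lemma poisson_pencilE s xi x y : poisson_pencil br N s xi x y =
  \tr (pencil_adjoint (dual_mx xi) (pencil_diag s) (phi x) *m phi y).
Proof.
have phi_deformed u v : phi (deformed_bracket br N u v) =
    phi u *m diag lambda *m phi v - phi v *m diag lambda *m phi u.
  rewrite -deformed_bracket_left_mul /deformed_bracket.
  by rewrite linearB linearD !phi_br !phi_N phi_br.
rewrite /poisson_pencil /lie_poisson -{1 2}[xi]dual_mxK !trace_formE.
rewrite phi_br phi_deformed pencil_adjointE pencil_diagE /commutator.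
set M := dual_mx xi; set A := diag lambda; move: (phi x) (phi y) => {}x {}y.
rewrite -!mxtraceZ -mxtraceD.
rewrite !(mulmxDl, mulmxDr, mulmxBl, mulmxBr, mulmxN, mulNmx, scalerBr,
  mul_scalar_mx, mul_mx_scalar).
rewrite -!(scalemxAl, scalemxAr) !(mxtraceD, mxtraceZ, raddfN, raddfB) /=.
rewrite !(mxtraceD, mxtraceZ) !mulmxA.
have -> : \tr (M *m y *m x) = \tr (x *m M *m y) by rewrite mxtrace_mulC mulmxA.
have -> : \tr (M *m y *m A *m x) = \tr (A *m x *m M *m y).
  by rewrite -mulmxA mxtrace_mulC !mulmxA.
by rewrite opprD addrACA.
Qed.

Lemma poisson_pencil_linr s xi x : linear (poisson_pencil br N s xi x : g -> C^o).
Proof.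
move=> a u v; rewrite !poisson_pencilE linearP mulmxDr -scalemxAr.
by rewrite mxtraceD mxtraceZ.
Qed.

Lemma poisson_pencil_linl s xi y :
  linear ((poisson_pencil br N s xi)^~ y : g -> C^o).
Proof.
move=> a u v; rewrite !poisson_pencilE !linearP mulmxDl -scalemxAl.
by rewrite mxtraceD mxtraceZ.
Qed.

Lemma rank_poisson_pencil s xi :
  (\dim (lker (pencil_adjoint (dual_mx xi) (pencil_diag s)))
   + bivector_rank (poisson_pencil br N s xi))%N = \dim {: g}.
Proof.
rewrite -(bivector_rank_ker (poisson_pencil br N s xi)); congr addn.
set K := lker (bivector_map _).
have KE x : (x \in K) =
    (phi x \in lker (pencil_adjoint (dual_mx xi) (pencil_diag s))).
  rewrite mem_lker_bivector_map; first last.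
  - exact: poisson_pencil_linl.
  - exact: poisson_pencil_linr.
  rewrite memv_ker; apply/boolp.asboolP/eqP => [x0|x0 y]; last first.
    by rewrite poisson_pencilE x0 mul0mx mxtrace0.
  apply/matrixP => i j; rewrite mxE -mxtrace_mul_delta -[delta_mx _ _]psiK.
  by rewrite -poisson_pencilE.
have /limg_dim_eq <- : (K :&: lker (linfun phi) = 0)%VS.
  apply/eqP; rewrite -subv0; apply/subvP => x.
  rewrite memv_cap memv0 [X in _ && X]memv_ker lfunE => /andP[_ /eqP x0].
  by rewrite -(can_eq phiK) x0 linear0.
congr (\dim _); apply/vspaceP => y; apply/idP/memv_imgP => [yK|[x xK ->]].
  by exists (psi y); rewrite ?lfunE ?KE /= psiK.
by rewrite lfunE -KE.
Qed.

(** Two diagonal entries of [B] that vanish for the same [s] would give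
    [s.2 * (lambda i - lambda j) = 0]. *)
Lemma pencil_diag_neq0 (s : C * C) i j : s != 0 -> i != j ->
  (s.1 + s.2 * lambda i != 0) || (s.1 + s.2 * lambda j != 0).
Proof.
move=> s0 ij; rewrite -negb_and; apply: contraNN s0 => /andP[/eqP si /eqP sj].
have: s.2 * (lambda i - lambda j) = 0.
  by rewrite mulrBr -(subrr 0) -{1}si -sj opprD addrACA subrr add0r.
move/eqP; rewrite mulf_eq0 subr_eq0 (negPf (lambda_inj ij)) orbF => /eqP s2.
by move: si; case: s s2 {sj} => s1 s2 /= ->; rewrite mul0r addr0 => ->.
Qed.

(** The open dense set is given by two polynomial functions: one is nonzero at
    the shift matrix and bounds the rank from below, the other is the
    determinant and bounds it from above. *)
Lemma kronecker_gl : kronecker (poisson_pencil br N).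
Proof.
pose r := (\dim {: g} - n)%N.
have full0 : full_gram br N r (trace_form (shift_mx C n)).
  move=> s s0; apply: bivector_rank_gram.
  - exact: poisson_pencil_linr.
  - exact: poisson_pencil_linl.
  rewrite leq_subLR -(rank_poisson_pencil s (trace_form (shift_mx C n))).
  rewrite leq_add2r trace_formK; apply: dim_shift_kernel => i j.
  exact: pencil_diag_neq0.
have [F [pF F0 FP]] := generic_full_gram full0.
pose D xi := \det (dual_mx xi).
have pD : polyfun D.
  apply: polyfun_det => i j; under boolp.eq_fun do rewrite mxE.
  exact: polyfun_ev.
have D1 : D (trace_form 1%:M) != 0 by rewrite /D trace_formK det1 oner_neq0.
exists ([set xi | F xi != 0] `&` [set xi | D xi != 0])%classic; split.
- by apply: openI; exact: polyfun_open.
- apply: denseI; [exact: polyfun_open | exact: polyfun_dense F0 |].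
  exact: polyfun_dense D1.
move=> xi [Fxi Dxi] s t s0 t0.
suff rankE u : u != 0 -> bivector_rank (poisson_pencil br N u xi) = r.
  by rewrite !rankE.
move=> u0; apply/eqP; rewrite eqn_leq; apply/andP; split.
  rewrite leq_subRL -(rank_poisson_pencil u xi) ?leq_add2r.
    by apply: pencil_kernel_dim; rewrite unitmxE unitfE.
  by apply: leq_trans (leq_addr _ _); apply: pencil_kernel_dim; rewrite unitmxE unitfE.
have [x [y xy]] := FP xi Fxi u u0.
exact: leq_bivector_rank (poisson_pencil_linr _ _) (poisson_pencil_linl _ _) _ _ _ xy.
Qed.

End KroneckerPencil.

(** * Complexified real matrices *)

Section ComplexifiedMatrices.
Variables (R : realType) (n : nat).
Local Open Scope complex_scope.

Definition complexify_mx (w : complexification 'M[R]_n) : 'M[R[i]]_n :=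
  map_mx (real_complex R) w.1 + 'i *: map_mx (real_complex R) w.2.

Definition split_mx (x : 'M[R[i]]_n) : complexification 'M[R]_n :=
  (map_mx (@complex.Re R) x, map_mx (@complex.Im R) x).

Lemma complexify_mxE w i j : complexify_mx w i j = w.1 i j +i* w.2 i j.
Proof. by rewrite !mxE; simpc. Qed.

Lemma complexify_mx_linear : linear complexify_mx.
Proof.
move=> [a1 a2] w z; apply/matrixP => i j.
rewrite [RHS]mxE [X in _ = X + _]mxE !complexify_mxE /=.
by rewrite !mxE; simpc.
Qed.
HB.instance Definition _ := GRing.isLinear.Build _ _ _ _ complexify_mx
  complexify_mx_linear.

Lemma complexify_mxK : cancel complexify_mx split_mx.
Proof.
by case=> u v; congr (_, _); apply/matrixP => i j; rewrite mxE complexify_mxE.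
Qed.

Lemma split_mxK : cancel split_mx complexify_mx.
Proof.
move=> x; apply/matrixP => i j; rewrite complexify_mxE !mxE.
by case: (x i j).
Qed.

Lemma complexify_mxM w z : complexify_mx w *m complexify_mx z =
  complexify_mx (w.1 *m z.1 - w.2 *m z.2, w.1 *m z.2 + w.2 *m z.1).
Proof.
rewrite /complexify_mx /= !(map_mxD, map_mxN, map_mxM) mulmxDl !mulmxDr.
rewrite -!(scalemxAl, scalemxAr) scalerA -expr2 sqr_i scaleN1r scalerDr.
by rewrite [X in _ + _ + X = _]addrC addrACA.
Qed.

Lemma complexify_mx_commutator w z :
  complexify_mx (complexify_bracket (@commutator R n) w z) =
  commutator (complexify_mx w) (complexify_mx z).
Proof.
rewrite [RHS]/commutator !complexify_mxM -linearB /=; congr complexify_mx.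
rewrite /complexify_bracket /commutator; congr (_, _) => /=.
  by rewrite !opprB [LHS]addrACA [RHS]addrACA; congr (_ + _); rewrite addrC.
by rewrite addrACA -opprD [X in _ - X]addrC.
Qed.

Lemma complexify_mx_left_mul (lambda : 'I_n -> R) w :
  complexify_mx (complexify_map (left_mul (diag lambda)) w) =
  left_mul (diag (fun i => (lambda i)%:C)) (complexify_mx w).
Proof.
apply/matrixP => i j.
rewrite complexify_mxE /= /left_mul !diag_mull complexify_mxE.
by simpc; congr (_ +i* _); exact: diag_mull.
Qed.

End ComplexifiedMatrices.

Theorem mainTheorem4 (R : realType) (n : nat) :
  (forall lambda : 'I_n -> R,
     (forall i j : 'I_n, i != j -> lambda i != lambda j) ->
     kronecker
       (poisson_pencil
          (complexify_bracket (@commutator R n))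
          (complexify_map (left_mul (diag lambda)))))
  /\
  (forall lambda : 'I_n -> R[i],
     (forall i j : 'I_n, i != j -> lambda i != lambda j) ->
     kronecker
       (poisson_pencil (@commutator R[i] n) (left_mul (diag lambda)))).
Proof.
split=> lambda lambda_inj.
- apply: (kronecker_gl (@complexify_mxK R n) (@split_mxK R n)
    (@complexify_mx_commutator R n) (@complexify_mx_left_mul R n lambda)).
  by move=> i j /lambda_inj; apply: contra_neq => /(congr1 (@complex.Re R)).
- by apply: (@kronecker_gl R[i] n 'M[R[i]]_n idfun id (fun=> erefl)
    (fun=> erefl) (@commutator R[i] n) (left_mul (diag lambda)) lambda).
Qed.
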